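(* Let $R$ be a commutative ring of Krull dimension zero. Then the canonical ring map $R \to T(R)$, $r \mapsto r/1$, from $R$ to its total ring of fractions is an isomorphism.
   Context: Rings have an identity. The total ring of fractions $T(R)$ is the localization $S^{-1}R$ where $S$ is the multiplicative set of all non-zero-divisors of $R$. (No Noetherian assumption is made.) *)

(* Defs.v *)
From HB Require Import structures.
From mathcomp Require Import all_boot all_order all_algebra.
From mathcomp Require Import generic_quotient ring_quotient ring.
From mathcomp Require Import boolp.

Set Implicit Arguments.
Unset Strict Implicit.
Unset Printing Implicit Defensive.

Import GRing.Theory.
Local Open Scope ring_scope.
Local Open Scope quotient_scope.

(* P_0 < P_1 < ... < P_n: such a chain of n+1 primes has length n. *)
Definition prime_chain (R : comNzRingType) (n : nat)
    (P : 'I_n.+1 -> prime_idealr R) : Prop :=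
  forall i j : 'I_n.+1, (i < j)%N ->
    {subset P i <= P j} /\ ~ {subset P j <= P i}.

(* The Krull dimension, i.e. the supremum of the lengths of chains of prime
   ideals, is the natural number n.  The zero ring, excluded here by
   comNzRingType, has no prime ideal and hence no dimension in nat. *)
Definition has_krull_dim (R : comNzRingType) (n : nat) : Prop :=
  (exists P : 'I_n.+1 -> prime_idealr R, prime_chain P) /\
  (forall (m : nat) (P : 'I_m.+1 -> prime_idealr R),
     prime_chain P -> (m <= n)%N).

Section Localization.
Variables (R : comPzRingType) (S : mulrClosed R).

Local Notation denom := {s : R | s \in S}.

Definition denom1 : denom := exist _ 1 (rpred1 S).
Definition denomM (s t : denom) : denom :=
  exist _ (sval s * sval t) (rpredM (valP s) (valP t)).

Local Notation preloc := (R * denom)%type.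
Implicit Types x y z : preloc.

Definition loc_equiv x y : bool :=
  `[< exists2 u, u \in S & u * (x.1 * sval y.2 - y.1 * sval x.2) = 0 >].

Lemma loc_equiv_refl : reflexive loc_equiv.
Proof. by move=> x; apply/asboolP; exists 1; rewrite ?rpred1 ?subrr ?mulr0. Qed.

Lemma loc_equiv_sym : symmetric loc_equiv.
Proof.
have sub x y : loc_equiv x y -> loc_equiv y x.
  by move=> /asboolP[u uS e]; apply/asboolP; exists u; rewrite // -opprB mulrN e oppr0.
by move=> x y; apply/idP/idP; apply: sub.
Qed.

Lemma loc_equiv_trans : transitive loc_equiv.
Proof.
move=> y x z /asboolP[u uS exy] /asboolP[v vS eyz]; apply/asboolP.
exists (u * v * sval y.2); first by rewrite !rpredM ?(valP y.2).
transitivity (v * sval z.2 * (u * (x.1 * sval y.2 - y.1 * sval x.2)) +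
              u * sval x.2 * (v * (y.1 * sval z.2 - z.1 * sval y.2))); first ring.
by rewrite exy eyz !mulr0 addr0.
Qed.

Canonical loc_equiv_equiv :=
  EquivRel loc_equiv loc_equiv_refl loc_equiv_sym loc_equiv_trans.

Definition localization : Type := {eq_quot loc_equiv}.
HB.instance Definition _ : EqQuotient _ loc_equiv localization :=
  EqQuotient.on localization.
HB.instance Definition _ := Choice.on localization.

Definition loc_frac (r : R) (s : denom) : localization := \pi_localization (r, s).

Lemma loc_fracP r s r' s' :
  loc_frac r s = loc_frac r' s' <->
  exists2 u, u \in S & u * (r * sval s' - r' * sval s) = 0.
Proof.
split=> [/eqmodP/asboolP // | e]; apply/eqmodP; exact/asboolP.
Qed.

Lemma loc_frac_surj (a : localization) : exists r s, a = loc_frac r s.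
Proof. by exists (repr a).1, (repr a).2; rewrite /loc_frac -surjective_pairing reprK. Qed.

Definition loc_zero : localization := loc_frac 0 denom1.
Definition loc_one : localization := loc_frac 1 denom1.
(* Through the chosen representatives; the equations loc_addE, loc_oppE and
   loc_mulE below show independence of that choice. *)
Definition loc_add (a b : localization) : localization :=
  let: x := repr a in let: y := repr b in
  loc_frac (x.1 * sval y.2 + y.1 * sval x.2) (denomM x.2 y.2).
Definition loc_opp (a : localization) : localization :=
  let: x := repr a in loc_frac (- x.1) x.2.
Definition loc_mul (a b : localization) : localization :=
  let: x := repr a in let: y := repr b in
  loc_frac (x.1 * y.1) (denomM x.2 y.2).

Lemma repr_loc_frac r s :
  exists2 u, u \in S &
    u * ((repr (loc_frac r s)).1 * sval s - r * sval (repr (loc_frac r s)).2) = 0.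
Proof. by apply/loc_fracP; rewrite /loc_frac -surjective_pairing reprK. Qed.

Lemma loc_addE r s r' s' :
  loc_add (loc_frac r s) (loc_frac r' s') =
  loc_frac (r * sval s' + r' * sval s) (denomM s s').
Proof.
rewrite /loc_add.
have [u uS] := repr_loc_frac r s; have [v vS] := repr_loc_frac r' s'.
case: (repr _) => [b t]; case: (repr _) => [a q] /= ev eu.
apply/loc_fracP; exists (u * v); first exact: rpredM.
rewrite /=.
transitivity (v * sval t * sval s' * (u * (a * sval s - r * sval q)) +
              u * sval q * sval s * (v * (b * sval s' - r' * sval t))); first ring.
by rewrite eu ev !mulr0 addr0.
Qed.

Lemma loc_oppE r s : loc_opp (loc_frac r s) = loc_frac (- r) s.
Proof.
rewrite /loc_opp; have [u uS] := repr_loc_frac r s.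
case: (repr _) => [a q] /= eu.
by apply/loc_fracP; exists u => //; rewrite !mulNr -opprD mulrN eu oppr0.
Qed.

Lemma loc_mulE r s r' s' :
  loc_mul (loc_frac r s) (loc_frac r' s') = loc_frac (r * r') (denomM s s').
Proof.
rewrite /loc_mul.
have [u uS] := repr_loc_frac r s; have [v vS] := repr_loc_frac r' s'.
case: (repr _) => [b t]; case: (repr _) => [a q] /= ev eu.
apply/loc_fracP; exists (u * v); first exact: rpredM.
rewrite /=.
transitivity (v * b * sval s' * (u * (a * sval s - r * sval q)) +
              u * r * sval q * (v * (b * sval s' - r' * sval t))); first ring.
by rewrite eu ev !mulr0 addr0.
Qed.

Lemma loc_frac_eq r s r' s' :
  r * sval s' = r' * sval s -> loc_frac r s = loc_frac r' s'.
Proof.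
by move=> e; apply/loc_fracP; exists 1; rewrite ?rpred1 // e subrr mulr0.
Qed.

Lemma loc_addA : associative loc_add.
Proof.
move=> a b c; have [ra [sa ->]] := loc_frac_surj a.
have [rb [sb ->]] := loc_frac_surj b; have [rc [sc ->]] := loc_frac_surj c.
by rewrite !loc_addE; apply: loc_frac_eq => /=; ring.
Qed.

Lemma loc_addC : commutative loc_add.
Proof.
move=> a b; have [ra [sa ->]] := loc_frac_surj a.
have [rb [sb ->]] := loc_frac_surj b.
by rewrite !loc_addE; apply: loc_frac_eq => /=; ring.
Qed.

Lemma loc_add0 : left_id loc_zero loc_add.
Proof.
move=> a; have [ra [sa ->]] := loc_frac_surj a.
by rewrite !loc_addE; apply: loc_frac_eq => /=; ring.
Qed.

Lemma loc_addN : left_inverse loc_zero loc_opp loc_add.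
Proof.
move=> a; have [ra [sa ->]] := loc_frac_surj a.
by rewrite loc_oppE loc_addE; apply: loc_frac_eq => /=; ring.
Qed.

HB.instance Definition _ :=
  GRing.isZmodule.Build localization loc_addA loc_addC loc_add0 loc_addN.

Lemma loc_mulA : associative loc_mul.
Proof.
move=> a b c; have [ra [sa ->]] := loc_frac_surj a.
have [rb [sb ->]] := loc_frac_surj b; have [rc [sc ->]] := loc_frac_surj c.
by rewrite !loc_mulE; apply: loc_frac_eq => /=; ring.
Qed.

Lemma loc_mulC : commutative loc_mul.
Proof.
move=> a b; have [ra [sa ->]] := loc_frac_surj a.
have [rb [sb ->]] := loc_frac_surj b.
by rewrite !loc_mulE; apply: loc_frac_eq => /=; ring.
Qed.

Lemma loc_mul1 : left_id loc_one loc_mul.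
Proof.
move=> a; have [ra [sa ->]] := loc_frac_surj a.
by rewrite loc_mulE; apply: loc_frac_eq => /=; ring.
Qed.

Lemma loc_mulDl : left_distributive loc_mul +%R.
Proof.
move=> a b c; have [ra [sa ->]] := loc_frac_surj a.
have [rb [sb ->]] := loc_frac_surj b; have [rc [sc ->]] := loc_frac_surj c.
rewrite -[RHS]/(loc_add _ _) -[X in loc_mul X _]/(loc_add _ _).
rewrite !(loc_addE, loc_mulE).
by apply: loc_frac_eq => /=; ring.
Qed.

HB.instance Definition _ :=
  GRing.Zmodule_isComPzRing.Build localization
    loc_mulA loc_mulC loc_mul1 loc_mulDl.

Definition to_loc (r : R) : localization := loc_frac r denom1.

Lemma to_loc_is_zmod_morphism : zmod_morphism to_loc.
Proof.
move=> r r'; rewrite /to_loc.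
rewrite -[RHS]/(loc_add _ (loc_opp _)) loc_oppE loc_addE.
by apply: loc_frac_eq => /=; ring.
Qed.

Lemma to_loc_is_monoid_morphism : monoid_morphism to_loc.
Proof.
split=> // r r'; rewrite -[RHS]/(loc_mul _ _) loc_mulE.
by apply: loc_frac_eq => /=; ring.
Qed.

HB.instance Definition _ :=
  GRing.isZmodMorphism.Build R localization to_loc to_loc_is_zmod_morphism.
HB.instance Definition _ :=
  GRing.isMonoidMorphism.Build R localization to_loc to_loc_is_monoid_morphism.

End Localization.

Definition nonzerodiv (R : comPzRingType) : {pred R} :=
  fun x => `[< forall y : R, x * y = 0 -> y = 0 >].

Lemma nonzerodiv_mulr_closed (R : comPzRingType) : mulr_closed (@nonzerodiv R).
Proof.
split=> [|x y /asboolP hx /asboolP hy]; apply/asboolP => z.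
  by rewrite mul1r.
by rewrite -mulrA => /hx/hy.
Qed.

HB.instance Definition _ (R : comPzRingType) :=
  GRing.isMulClosed.Build R (@nonzerodiv R) (@nonzerodiv_mulr_closed R).

Definition total_fractions (R : comPzRingType) : comPzRingType :=
  localization (@nonzerodiv R).

Definition to_total_fractions (R : comPzRingType) :
    {rmorphism R -> total_fractions R} :=
  @to_loc R (@nonzerodiv R).

(* Main.v *)
(** In a ring of dimension zero every non-zero-divisor x is a unit, hence
    already invertible before localizing.  Otherwise the multiplicative set of
    the elements x^n (1 - x a) would not contain 0 and would be avoided by some
    prime P.  As P contains no element 1 - x a, the ideal P + (x) is proper;
    a prime Q above it contains x while P does not, and P < Q has length 1. *)
Require Import Defs.
From mathcomp Require Import all_boot all_order all_algebra.
From HB Require Import structures.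
From mathcomp Require Import ring_quotient ring boolp classical_sets.

Set Implicit Arguments.
Unset Strict Implicit.
Unset Printing Implicit Defensive.

Import GRing.Theory.
Local Open Scope ring_scope.
Local Open Scope classical_set_scope.

Definition ideal_set (R : comNzRingType) (I : set R) : Prop :=
  I 0 /\ forall a u v, I u -> I v -> I (a * u + v).

(** The set is the ideal I + (x). *)
Lemma ideal_set_add_principal (R : comNzRingType) (I : set R) (x : R) :
  ideal_set I -> ideal_set [set y | exists a, I (y - a * x)].
Proof.
move=> [I0 IL]; split=> [|a u v [b Iu] [c Iv]] /=.
  by exists 0; rewrite mul0r subr0.
exists (a * b + c).
have -> : a * u + v - (a * b + c) * x = a * (u - b * x) + (v - c * x) by ring.
exact: IL.
Qed.

Lemma ideal_set_prime_idealr (R : comNzRingType) (P : prime_idealr R) :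
  ideal_set [set x | x \in P].
Proof.
by split=> [|a u v uP vP]; [exact: idealr0 | rewrite /= rpredD ?idealMr].
Qed.

Lemma prime_idealr_of_set (R : comNzRingType) (I : set R) :
  ideal_set I -> ~ I 1 -> (forall u v, I (u * v) -> I u \/ I v) ->
  exists P : prime_idealr R, forall x, x \in P <-> I x.
Proof.
move=> [I0 IL] I1 Iprime.
pose J : R -> bool := fun x => `[< I x >].
have Jid : idealr_closed J.
  split; [exact/asboolP | exact/asboolPn |].
  by move=> a u v /asboolP Iu /asboolP Iv; apply/asboolP/IL.
have Jprime : prime_idealr_closed J.
  by move=> u v /asboolP/Iprime[] Ix; apply/orP; [left | right]; apply/asboolP.
pose Z := GRing.isZmodClosed.Build R J (idealr_closedB Jid).
pose N := isProperIdeal.Build R J (idealr_closed_nontrivial Jid).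
pose M := isPrimeIdealrClosed.Build R J Jprime.
pose P : prime_idealr R := HB.pack J Z N M.
by exists P => x; split=> /asboolP.
Qed.

(** By Zorn's lemma some ideal is maximal among those containing [I] and disjoint from [S]; the
    multiplicativity of [S] forces it to be prime. *)
Lemma exists_prime_idealr_avoiding (R : comNzRingType) (I S : set R) :
  ideal_set I -> S 1 -> (forall s t, S s -> S t -> S (s * t)) ->
  (forall x, I x -> ~ S x) ->
  exists P : prime_idealr R,
    (forall x, I x -> x \in P) /\ (forall x, S x -> x \notin P).
Proof.
move=> Iid S1 SM IS; have [I0 IL] := Iid.
(* The empty set is admitted so that the empty chain has an upper bound. *)
pose good (A : set R) :=
  [/\ forall a u v, A u -> A v -> A (a * u + v),
      forall x, A x -> ~ S x & forall x, A x -> I `<=` A].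
have [F Fgood Ftot|A [[AL AS AI] Amax]] := @Zorn_bigcup R good.
  split=> [a u v [X FX Xu] [Y FY Yv]|x [X FX Xx]|x [X FX Xx] y Iy].
  - have [XY|YX] := Ftot _ _ FX FY.
      by exists Y => //; have [YL _ _] := Fgood _ FY; apply: YL => //; apply: XY.
    by exists X => //; have [XL _ _] := Fgood _ FX; apply: XL => //; apply: YX.
  - by have [_ XS _] := Fgood _ FX; exact: XS.
  - by exists X => //; have [_ _ XI] := Fgood _ FX; exact: XI Xx _ Iy.
(* Were [A] empty, [I] would be a strictly larger good set. *)
have [x Ax] : exists x, A x.
  apply: contrapT => /forallNP A0.
  have AI' : A `<` I by split=> [x /A0 //|/(_ _ I0) /A0].
  by apply: (Amax _ AI'); split=> [//|//|y _ z].
have IA := AI _ Ax.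
have Aid : ideal_set A by split=> //; exact: IA.
(* By maximality, A + (u) meets [S] as soon as [u] is outside [A]. *)
have meetS u : ~ A u -> exists2 s, S s & exists a, A (s - a * u).
  move=> nAu; apply: contrapT => nmeet.
  have [B0 BL] := ideal_set_add_principal u Aid.
  have AB : A `<=` [set y | exists a, A (y - a * u)].
    by move=> y Ay; exists 0; rewrite mul0r subr0.
  apply: (Amax [set y | exists a, A (y - a * u)]).
    split=> // /(_ u) nAu'; apply/nAu/nAu' => /=.
    by exists 1; rewrite mul1r subrr; exact: IA.
  split=> // [y By Sy|y _ z /IA /AB //]; apply: nmeet; by exists y.
have [|u v Auv|P PA] := prime_idealr_of_set Aid.
- by move=> /AS; apply.
- apply: contrapT => /not_orP[/meetS[s Ss [a Aa]] /meetS[t St [b Ab]]].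
  apply: (AS (s * t)); last exact: SM.
  have [A0 _] := Aid.
  (* Modulo [A], s = a u and t = b v, so s t = a b (u v) = 0, although s t lies in [S]. *)
  have -> : s * t = t * (s - a * u) + (a * u * (t - b * v)
                    + (a * b * (u * v) + 0)) by ring.
  exact: AL Aa (AL _ _ _ Ab (AL _ _ _ Auv A0)).
- exists P; split=> [y /IA Ay|y Sy]; first exact/PA.
  by apply/negP => /PA /AS; apply.
Qed.

Lemma krull_dim0_nonzerodiv_unit (R : comNzRingType) (x : R) :
  has_krull_dim R 0 -> x \in @nonzerodiv R -> exists y, x * y = 1.
Proof.
move=> [_ dim0] /asboolP xreg; apply: contrapT => xnunit.
have xnreg n y : x ^+ n * y = 0 -> y = 0.
  by elim: n => [|n IH]; rewrite ?mul1r // exprS -mulrA => /xreg.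
pose S := [set y : R | exists n a, y = x ^+ n * (1 - x * a)].
(* If 0 = x^n (1 - x a), regularity of x^n gives x a = 1, which is excluded. *)
have [||s t [n [a ->]] [m [b ->]]|_ -> [n [a /esym/xnreg/subr0_eq xa]]|P [_ PS]] :=
  @exists_prime_idealr_avoiding R [set 0] S.
- by split=> // a u v -> ->; rewrite /= mulr0 addr0.
- by exists 0%N, 0; rewrite mulr0 subr0 mulr1.
(* (1 - x a)(1 - x b) = 1 - x (a + b - x a b). *)
- by exists (n + m)%N, (a + b - x * a * b); rewrite exprD; ring.
- by apply: xnunit; exists a.
have nPx : x \notin P by apply: PS; exists 1%N, 0; rewrite mulr0 subr0 mulr1.
have Pid := ideal_set_add_principal x (ideal_set_prime_idealr P).
(* Avoiding 1 just means being proper, so this yields a prime above P + (x). *)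
have [||y [a yP] y1|Q [PQ _]] := exists_prime_idealr_avoiding (S := [set 1]) Pid.
- by [].
- by move=> s t -> ->; rewrite /= mulr1.
- move: yP; rewrite /= y1; apply/negP/PS.
  by exists 0%N, a; rewrite mul1r [a * x]mulrC.
have Qx : x \in Q by apply: PQ; exists 1; rewrite /= mul1r subrr idealr0.
suff /dim0 : prime_chain (fun i : 'I_2 => if i == ord0 then P else Q) by [].
move=> [[|[|//]] i2] [[|[|//]] j2] //= _; split=> [y yP|QP].
  by apply: PQ; exists 0; rewrite /= mul0r subr0.
by move: nPx; rewrite QP.
Qed.

Theorem lemma4p11 (R : comNzRingType) (hR : has_krull_dim R 0) :
  bijective (to_total_fractions R).
Proof.
(* Equality of r/1 and r'/1 means u (r - r') = 0 for a non-zero-divisor u. *)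
have inj : injective (to_total_fractions R).
  move=> r r' /loc_fracP[u /asboolP ureg].
  by rewrite /= !mulr1 => /ureg/subr0_eq.
(* If s y = 1, then r/s = (r y)/1. *)
have surj (z : total_fractions R) : exists r, to_total_fractions R r = z.
  have [r [s ->]] := loc_frac_surj z.
  have [y sy] := krull_dim0_nonzerodiv_unit hR (valP s).
  by exists (r * y); apply: loc_frac_eq; rewrite /= mulr1 -mulrA [y * _]mulrC sy mulr1.
have [g gK] := choice surj.
by exists g => // r; apply: inj; rewrite gK.
Qed.
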